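(* Let $\boldsymbol T=(T_1,\ldots,T_d)$ be a $d$-tuple of spherical joint weighted shift operators with associated sequence $(\delta_n)_{n\ge 0}$. Suppose that $\delta_n\uparrow 1$ (i.e. $(\delta_n)$ is increasing with limit $1$). Then $$\mathrm{trace}\,\big(\mathrm{dEt}\big([\![\boldsymbol T^*,\boldsymbol T]\!]\big)\big)=1.$$
   Context: A $d$-tuple of spherical joint weighted shift operators with associated sequence $(\delta_n)_{n\ge0}$ (a bounded sequence of positive numbers) is the commuting $d$-tuple $\boldsymbol T=(T_1,\ldots,T_d)$ acting on a Hilbert space with orthonormal basis $\{x_{\boldsymbol\alpha}:\boldsymbol\alpha\in\mathbb N_0^d\}$ by $$T_ix_{\boldsymbol\alpha}=\delta_{|\boldsymbol\alpha|}\sqrt{\frac{\alpha_i+1}{|\boldsymbol\alpha|+d}}\;x_{\boldsymbol\alpha+\epsilon_i},\qquad 1\le i\le d,$$ where $|\boldsymbol\alpha|=\alpha_1+\cdots+\alpha_d$ and $\epsilon_i$ is the $i$-th standard unit multi-index. For a commuting $d$-tuple $\boldsymbol T$ of bounded operators, $[\![\boldsymbol T^*,\boldsymbol T]\!]$ is the $d\times d$ block operator with $(i,j)$ entry $B_{ij}=[T_j^*,T_i]=T_j^*T_i-T_iT_j^*$, and $$\mathrm{dEt}\big([\![\boldsymbol T^*,\boldsymbol T]\!]\big):=\sum_{\sigma,\tau\in\mathfrak S_d}\mathrm{Sgn}(\sigma)\,B_{\tau(1),\sigma(\tau(1))}B_{\tau(2),\sigma(\tau(2))}\cdots B_{\tau(d),\sigma(\tau(d))},$$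 where $\mathfrak S_d$ is the permutation group on $d$ symbols. *)

(* Defs.v *)
From HB Require Import structures.
From mathcomp Require Import all_boot all_order all_algebra.
From mathcomp Require Import all_fingroup.
From mathcomp Require Import sesquilinear complex finmap.
From mathcomp Require Import all_classical all_reals all_analysis.
From mathcomp Require Import summability.

Set Implicit Arguments.
Unset Strict Implicit.
Unset Printing Implicit Defensive.

Import Order.TTheory GRing.Theory Num.Theory.
Import numFieldNormedType.Exports.

Local Open Scope classical_set_scope.
Local Open Scope ring_scope.
Local Open Scope complex_scope.

(* A complex Hilbert space is a complete normed space H over R[i] together    *)
(* with an inner product ip, linear in its first argument and conjugate-linear *)
(* in the second, that induces the norm of H.                                  *)
Notation inner_product H := {dot H for Num.conj}.

Definition induces_norm (R : realType) (H : completeNormedModType R[i])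
    (ip : inner_product H) : Prop :=
  forall u : H, ip u u = `|u| ^+ 2.

Definition lin_span (R : realType) (H : completeNormedModType R[i])
    (I : choiceType) (e : I -> H) : set H :=
  [set v | exists (s : seq I) (c : I -> R[i]), v = \sum_(i <- s) c i *: e i].

Definition orthonormal_basis (R : realType) (H : completeNormedModType R[i])
    (ip : inner_product H) (I : choiceType) (e : I -> H) : Prop :=
  (forall i j : I, ip (e i) (e j) = (i == j)%:R) /\
  closure (lin_span e) = [set: H].

(* For linear maps, boundedness is continuity (linear_bounded_continuous).     *)
Definition bounded_operator (R : realType) (H : completeNormedModType R[i])
    (A : H -> H) : Prop :=
  linear A /\ continuous A.

(* For a bounded operator A on a Hilbert space the set below is a singleton.   *)
Definition adjoint (R : realType) (H : completeNormedModType R[i])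
    (ip : inner_product H) (A : H -> H) : H -> H :=
  get [set B : H -> H | forall u v : H, ip (A u) v = ip u (B v)].

Definition positive_operator (R : realType) (H : completeNormedModType R[i])
    (ip : inner_product H) (P : H -> H) : Prop :=
  bounded_operator P /\ forall u : H, 0 <= ip (P u) u.

(* P = |A|, the positive square root of A^* A *)
Definition is_absolute_value (R : realType) (H : completeNormedModType R[i])
    (ip : inner_product H) (A P : H -> H) : Prop :=
  positive_operator ip P /\ P \o P = adjoint ip A \o A.

(* The sum over i of <A e_i, e_i>, as the limit of its finite partial sums,    *)
(* is t for every orthonormal basis e.                                         *)
Definition diagonal_sum (R : realType) (H : completeNormedModType R[i])
    (ip : inner_product H) (A : H -> H) (t : R[i]) : Prop :=
  forall (I : choiceType) (e : I -> H), orthonormal_basis ip e ->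
    partial_sum (fun i => ip (A (e i)) (e i)) @ totally --> (t : R[i]^o).

Definition trace_class (R : realType) (H : completeNormedModType R[i])
    (ip : inner_product H) (A : H -> H) : Prop :=
  bounded_operator A /\
  exists P : H -> H, is_absolute_value ip A P /\
    exists s : R[i], diagonal_sum ip P s.

Definition has_trace (R : realType) (H : completeNormedModType R[i])
    (ip : inner_product H) (A : H -> H) (t : R[i]) : Prop :=
  trace_class ip A /\ diagonal_sum ip A t.

Definition commutator (V : zmodType) (A B : V -> V) : V -> V :=
  fun u => A (B u) - B (A u).

Definition comm_block (R : realType) (H : completeNormedModType R[i])
    (ip : inner_product H) (d : nat) (T : 'I_d -> H -> H)
    (i j : 'I_d) : H -> H :=
  commutator (adjoint ip (T j)) (T i).

(* The big operator composes its factors in the order k = 0, ..., d-1, from    *)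
(* left to right.                                                              *)
Definition dEt (K : pzRingType) (V : lmodType K) (d : nat)
    (B : 'I_d -> 'I_d -> V -> V) : V -> V :=
  fun u => \sum_(s : 'S_d) \sum_(t : 'S_d)
    (-1) ^+ s *: (\big[@comp V V V/idfun]_(k < d) B (t k) (s (t k))) u.

Notation multi_index d := {ffun 'I_d -> nat}.

Definition mi_abs (d : nat) (a : multi_index d) : nat := (\sum_(i < d) a i)%N.

Definition mi_incr (d : nat) (a : multi_index d) (i : 'I_d) : multi_index d :=
  [ffun j => (a j + (j == i))%N].

Definition spherical_shift (R : realType) (H : completeNormedModType R[i])
    (d : nat) (x : multi_index d -> H) (delta : nat -> R)
    (T : 'I_d -> H -> H) : Prop :=
  [/\ forall n, 0 < delta n,
      bounded_fun delta,
      forall i, bounded_operator (T i)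
    & forall (i : 'I_d) (a : multi_index d),
        T i (x a) =
        (delta (mi_abs a) *
          Num.sqrt ((a i + 1)%:R / (mi_abs a + d)%:R))%:C *: x (mi_incr a i)].

(* Main.v *)
Require Import Defs.
From HB Require Import structures.
From mathcomp Require Import all_boot all_order all_algebra.
From mathcomp Require Import all_fingroup.
From mathcomp Require Import ring zify.
From mathcomp Require Import sesquilinear complex finmap.
From mathcomp Require Import all_classical all_reals all_analysis.
From mathcomp Require Import summability.

Import Order.TTheory GRing.Theory Num.Theory.
Import numFieldNormedType.Exports.

Local Open Scope classical_set_scope.
Local Open Scope ring_scope.
Local Open Scope complex_scope.

(** Put f_n = delta_n / sqrt (n + d) and rescale the basis to the monomials
    y_a = sqrt (a!) x_a.  Then T_i raises and its adjoint differentiates: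
      T_i y_a = f_n y_(a + e_i),    T_j^* y_a = f_(n-1) a_j y_(a - e_j),
    where n = |a|.  With h = f_n^2 and p = f_(n-1)^2 the commutator [T_j^*, T_i]
    acts on polynomials of degree n as h [i = j] + (h - p) z_i d/dz_j.

    The operators E_ij = z_i d/dz_j satisfy, besides the relations of gl_d, the
    relation E_ij E_kl - E_il E_kj = [j = k] E_il - [k = l] E_ij, because after
    normal ordering two derivatives commute.  In an antisymmetrised product of
    the blocks this relation collapses every product of two E's to a single E
    ([alt_GG], [alt_B]), so that for each fixed order of the rows the product
    sends y_a to an explicit multiple of itself ([alt_B_enum]).  Summing over
    the orders ([dEt_eigenvector]), dEt is diagonal on the basis x, with
    eigenvalue
      lambda_n = (d-1)! (d h^d + n (h^d - p^d))
    at each x_a with |a| = n.  There are 'C(n + d - 1, d - 1) such a, and the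
    contribution of degree n is a difference v_(n+1) - v_n, where
    v_(n+1) = ((n + d) ... (n + 1) / (n + d)^d) delta_n^(2d).  Hence the
    eigenvalues sum to lim v_n = 1 ([esum_dEt_eigenvalue]).

    Monotonicity of delta and Bernoulli's inequality give lambda_n >= 0
    ([dEt_eigenvalue_ge0]).  So dEt is a positive operator and is its own
    absolute value.  For a positive operator P that is diagonal in one
    orthonormal basis x with eigenvalues c, expanding <P u, u> as the sum of
    c_a |<u, x_a>|^2 and exchanging two nonnegative sums, Parseval's identity
    shows that the diagonal sum in every orthonormal basis equals the sum of
    the c_a ([diagonal_diagonal_sum]).  This yields both that dEt is trace class
    and that its trace is 1. *)

Set Implicit Arguments.
Unset Strict Implicit.
Unset Printing Implicit Defensive.

(** * Antisymmetrised products of the blocks *)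

(** The block B_ij is h [i = j] + G_ij, where G_ij stands for
    (h - p) z_i d/dz_j in one degree, so that g is h - p.  The rows of the
    products below are taken in the fixed order [t]; the antisymmetrisation
    is over the assignment [r] of columns. *)
Section Antisymmetrised.
Variables (K : numFieldType) (V : lmodType K) (d : nat) (t : 'S_d) (g h : K).
Variables (B G : 'I_d -> 'I_d -> {linear V -> V}) (x : V).
Hypothesis BE : forall i j u, B i j u = G i j u + (h * (i == j)%:R) *: u.
Hypothesis Gcomm : forall i j k l,
  G i j (G k l x) - G i l (G k j x) =
  g *: ((j == k)%:R *: G i l x - (k == l)%:R *: G i j x).

Definition alt_sum (F : 'S_d -> V) : V := \sum_(r : 'S_d) (-1) ^+ r *: F r.

Lemma alt_swap (F : 'S_d -> V) i j : i != j ->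
  alt_sum F = - alt_sum (fun r => F (tperm i j * r)%g).
Proof.
move=> ij; rewrite /alt_sum (reindex_inj (mulgI (tperm i j))) /= -sumrN.
apply: eq_bigr => r _.
by rewrite odd_permM odd_tperm ij addTb signrN scaleNr.
Qed.

Lemma altD F1 F2 : alt_sum (fun r => F1 r + F2 r) = alt_sum F1 + alt_sum F2.
Proof. by rewrite -big_split; apply: eq_bigr => r _; rewrite scalerDr. Qed.

Lemma altN F1 : alt_sum (fun r => - F1 r) = - alt_sum F1.
Proof. by rewrite -sumrN; apply: eq_bigr => r _; rewrite scalerN. Qed.

Lemma altZ a F1 : alt_sum (fun r => a *: F1 r) = a *: alt_sum F1.
Proof.
by rewrite scaler_sumr; apply: eq_bigr => r _; rewrite !scalerA mulrC.
Qed.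

Lemma eq_alt F1 F2 : F1 =1 F2 -> alt_sum F1 = alt_sum F2.
Proof. by move=> e; apply: eq_bigr => r _; rewrite e. Qed.

Local Notation dl r k := ((t k == r k)%:R : K).

Definition agree (r : 'S_d) (s : seq 'I_d) : K := \prod_(k <- s) dl r k.

(** The antisymmetrised product of the blocks in the rows [s] reduces to the
    scalar term [h ^+ size s * agree r s] plus this one, a sum over the position
    of the only row that is allowed to disagree with its column. *)
Fixpoint one_off (r : 'S_d) (s : seq 'I_d) : V :=
  if s is k :: s' then
    ((h - g) ^+ size s' * agree r s') *: G (t k) (r k) x +
    (h * dl r k) *: one_off r s'
  else 0.

(** Swapping the columns of the two factors G turns the antisymmetrised product
    into half of the antisymmetrised left-hand side of [Gcomm]; the two terms on
    its right-hand side are again exchanged by the swap, so they contribute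
    equally.  Dividing by 2 leaves a single factor G. *)
Lemma alt_GG (Y : 'S_d -> {linear V -> V}) k i : k != i ->
  (forall r u, Y (tperm k i * r)%g u = Y r u) ->
  alt_sum (fun r => Y r (G (t k) (r k) (G (t i) (r i) x))) =
  - (g *: alt_sum (fun r => Y r (dl r i *: G (t k) (r k) x))).
Proof.
move=> ki HY.
pose F1 r := Y r (G (t k) (r k) (G (t i) (r i) x)).
pose F2 (r : 'S_d) := Y r (G (t k) (r i) (G (t i) (r k) x)).
pose F3 (r : 'S_d) := Y r ((r k == t i)%:R *: G (t k) (r i) x).
pose F4 r := Y r (dl r i *: G (t k) (r k) x).
have E12 : alt_sum F2 = - alt_sum F1.
  rewrite (alt_swap F2 ki); congr (- _); apply: eq_alt => r.
  by rewrite /F2 HY !permM tpermL tpermR.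
have E34 : alt_sum F3 = - alt_sum F4.
  rewrite (alt_swap F3 ki); congr (- _); apply: eq_alt => r.
  by rewrite /F3 HY !permM tpermL tpermR eq_sym.
have E : alt_sum F1 - alt_sum F2 = g *: (alt_sum F3 - alt_sum F4).
  rewrite -!altN -!altD -altZ; apply: eq_alt => r.
  by rewrite /F1 /F2 /F3 /F4 -!linearB -linearZ Gcomm.
have : 2%:R *: alt_sum F1 = 2%:R *: - (g *: alt_sum F4).
  rewrite !scaler_nat !mulr2n.
  move: E; rewrite E12 E34 opprK => ->.
  by rewrite -opprD scalerN scalerDr opprD.
by move/scalerI; apply; rewrite pnatr_eq0.
Qed.

(** A further factor G in front of [one_off] always collapses by [alt_GG] onto
    its own row.  The coefficient is the telescoped geometric sum
    - g \sum_(j < n) h ^ j (h - g) ^ (n - 1 - j) = (h - g) ^ n - h ^ n. *)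
Lemma alt_G_one_off s k (Y : 'S_d -> {linear V -> V}) : uniq (k :: s) ->
  (forall i, i \in s -> forall r u, Y (tperm k i * r)%g u = Y r u) ->
  alt_sum (fun r => Y r (G (t k) (r k) (one_off r s))) =
  ((h - g) ^+ size s - h ^+ size s) *:
    alt_sum (fun r => Y r (agree r s *: G (t k) (r k) x)).
Proof.
elim: s Y => [|i s IH] Y.
  move=> _ _; rewrite subrr scale0r /alt_sum big1// => r _.
  by rewrite /= !linear0.
rewrite /= inE negb_or => /and3P[/andP[ki ks] nis us] HY.
(* The two summands of one_off (i :: s): in the first the factors G of the rows
   k and i meet, in the second the row i is frozen and the induction applies. *)
pose Y' (r : 'S_d) : {linear V -> V} := agree r s \*: Y r.
pose Y'' (r : 'S_d) : {linear V -> V} := (h * dl r i) \*: Y r.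
have agreeT j l (r : 'S_d) : j \notin s -> l \notin s ->
    agree (tperm j l * r)%g s = agree r s.
  move=> js ls; apply: eq_big_seq => m ms.
  have jm : j != m by apply: contraNneq js => ->.
  have lm : l != m by apply: contraNneq ls => ->.
  by rewrite permM tpermD.
transitivity ((h - g) ^+ size s *:
    alt_sum (fun r => Y' r (G (t k) (r k) (G (t i) (r i) x))) +
  alt_sum (fun r => Y'' r (G (t k) (r k) (one_off r s)))).
  rewrite -altZ -altD; apply: eq_alt => r.
  rewrite /Y' /Y'' /= [G _ _ _]linearP [Y r _]linearP /=.
  by rewrite [G _ _ (_ *: one_off _ _)]linearZ [Y r (_ *: _)]linearZ/= scalerA.
rewrite alt_GG//; last first.
  by move=> r u; rewrite /Y' /= HY ?inE ?eqxx// agreeT.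
rewrite IH; first last.
- move=> j js r u; rewrite /Y'' /= permM tpermD ?HY ?inE ?js ?orbT//.
  by apply: contraNneq nis => <-.
- by rewrite /= ks.
rewrite scalerN -scaleNr scalerA -!altZ -altD.
apply: eq_alt => r.
rewrite /Y' /Y'' /= [agree r (i :: s)]big_cons -/(agree r s).
rewrite !linearZ /= !scalerA -scalerDl; congr (_ *: _).
by rewrite !exprS; ring.
Qed.

(** Reduction of the product from its last row to its first: replacing the
    suffix [s] of the product by its normal form is legitimate as the prefix [Y]
    does not see permutations of the columns of [s].  Only the action of the
    relation on the vector [x] is needed, since [x] is where the suffix starts. *)
Lemma alt_B s (Y : 'S_d -> {linear V -> V}) : uniq s ->
  (forall i j, i \in s -> j \in s ->
     forall r u, Y (tperm i j * r)%g u = Y r u) ->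
  alt_sum (fun r => Y r (foldr (fun k => B (t k) (r k)) x s)) =
  alt_sum (fun r => Y r ((h ^+ size s * agree r s) *: x + one_off r s)).
Proof.
elim: s Y => [|k s IH] Y.
  move=> _ _; apply: eq_alt => r.
  by rewrite /= /agree big_nil expr0 mul1r scale1r addr0.
move=> /[dup] uks /= /andP[ks us] HY.
pose Y' (r : 'S_d) : {linear V -> V} := (Y r \o B (t k) (r k))%FUN.
transitivity
  (alt_sum (fun r => Y' r ((h ^+ size s * agree r s) *: x + one_off r s))).
  rewrite -IH// => i j si sj r u.
  rewrite /Y' /= HY ?inE ?si ?sj ?orbT// permM tpermD//.
    by apply: contraNneq ks => <-.
  by apply: contraNneq ks => <-.
pose F0 r := Y r ((h ^+ (size s).+1 * agree r (k :: s)) *: x).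
pose F1 r := Y r ((h ^+ size s * agree r s) *: G (t k) (r k) x).
pose F2 r := Y r (G (t k) (r k) (one_off r s)).
pose F3 r := Y r ((h * dl r k) *: one_off r s).
transitivity (alt_sum F0 + alt_sum F1 + alt_sum F2 + alt_sum F3).
  rewrite -!altD; apply: eq_alt => r.
  rewrite /Y' /F0 /F1 /F2 /F3 /= -!linearD; congr (Y r _).
  rewrite linearP BE BE /= [agree r (k :: s)]big_cons -/(agree r s).
  rewrite [X in X + (_ + _)]scalerDr scalerA exprS !addrA.
  by congr (_ + _ + _); rewrite addrC; congr (_ *: _ + _); ring.
rewrite /F2 alt_G_one_off//; last first.
  by move=> i si r u; rewrite HY ?inE ?eqxx ?si ?orbT.
rewrite -altZ -!altD; apply: eq_alt => r.
rewrite /F0 /F1 /F3 ![Y r (_ + _)]linearD -!addrA; congr (_ + _).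
rewrite addrA; congr (_ + _).
rewrite ![Y r (_ *: G _ _ _)]linearZ scalerA -scalerDl.
by congr (_ *: _); ring.
Qed.

Lemma agree_neq0 (r : 'S_d) s i : i \in s -> t i != r i -> agree r s = 0.
Proof.
by move=> si ti; rewrite /agree (big_rem i)//= (negPf ti) mul0r.
Qed.

(** Two permutations that differ do so at two places at least, so this kills all
    columns other than [r = t]. *)
Lemma one_off_neq0 (r : 'S_d) s i j : i != j -> i \in s -> j \in s ->
  t i != r i -> t j != r j -> one_off r s = 0.
Proof.
elim: s => //= k s IH ij; rewrite !inE => si sj ti tj.
have [ki|ki] := eqVneq i k.
  have sj' : j \in s by move: sj; rewrite -ki eq_sym (negPf ij).
  by rewrite (agree_neq0 sj' tj) -ki (negPf ti) !mulr0 !scale0r addr0.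
have si' : i \in s by move: si; rewrite (negPf ki).
rewrite (agree_neq0 si' ti) mulr0 scale0r add0r.
have [kj|kj] := eqVneq j k; first by rewrite -kj (negPf tj) mulr0 scale0r.
by rewrite IH ?scaler0//; move: sj; rewrite (negPf kj).
Qed.

Fixpoint one_off_eigenvalue (a : 'I_d -> K) (s : seq 'I_d) : K :=
  if s is k :: s' then
    (h - g) ^+ size s' * (g * a (t k)) + h * one_off_eigenvalue a s'
  else 0.

Lemma alt_B_enum (a : 'I_d -> K) :
  (forall i, G i i x = (g * a i) *: x) ->
  alt_sum (fun r => foldr (fun k => B (t k) (r k)) x (enum 'I_d)) =
  (-1) ^+ t *: ((h ^+ d + one_off_eigenvalue a (enum 'I_d)) *: x).
Proof.
move=> Ga; rewrite (alt_B (Y := fun=> idfun)) ?enum_uniq//=.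
rewrite /alt_sum (bigD1 t)//= [X in _ + X]big1 ?addr0 => [|r rt]; last first.
  have [i ti] : exists i, t i != r i.
    apply/existsP; rewrite -negb_forall; apply: contra rt => /forallP e.
    by apply/eqP/permP => i; apply/esym/eqP.
  (* The row whose agreeing column is already taken by i disagrees as well. *)
  pose j := (t^-1)%g (r i).
  have tj : t j = r i by rewrite permKV.
  have ij : i != j by apply: contraNneq ti => ij; rewrite {1}ij tj.
  have jt : t j != r j by rewrite tj (inj_eq perm_inj).
  rewrite (agree_neq0 (mem_enum _ i) ti) mulr0 scale0r add0r.
  by rewrite (one_off_neq0 ij _ _ ti jt) ?mem_enum ?scaler0.
congr (_ *: _).
have ag s : agree t s = 1 by rewrite /agree big1// => k _; rewrite eqxx.
rewrite ag mulr1 -cardE card_ord scalerDl; congr (_ + _).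
elim: (enum _) => /= [|k s ->]; first by rewrite scale0r.
by rewrite ag mulr1 eqxx mulr1 Ga !scalerA -scalerDl.
Qed.
End Antisymmetrised.

Lemma sum_perm_app (K : numFieldType) (d : nat) (a : 'I_d -> K) (k : 'I_d) :
  \sum_(t : 'S_d) a (t k) = (d.-1)`!%:R * \sum_i a i.
Proof.
have d0 : (0 < d)%N := leq_ltn_trans (leq0n k) (ltn_ord k).
have S l : \sum_(t : 'S_d) a (t l) = \sum_(t : 'S_d) a (t k).
  rewrite (reindex_inj (mulgI (tperm k l))) /=.
  by apply: eq_bigr => t _; rewrite permM tpermR.
have : d%:R * \sum_(t : 'S_d) a (t k) = d%:R * ((d.-1)`!%:R * \sum_i a i).
  rewrite mulrA -natrM -[in (d * _)%N](prednK d0) -factS prednK//.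
  transitivity (\sum_l \sum_(t : 'S_d) a (t l)).
    rewrite [RHS](eq_bigr _ (fun l _ => S l)).
    by rewrite sumr_const card_ord mulr_natl.
  rewrite exchange_big /=.
  rewrite (eq_bigr (fun=> \sum_i a i)) => [|r _]; last first.
    by rewrite [RHS](reindex_perm r).
  by rewrite sumr_const card_Sn mulr_natl.
by move/mulfI; apply; rewrite pnatr_eq0 -lt0n.
Qed.

Lemma sum_one_off_eigenvalue (K : numFieldType) (d : nat) (g h : K)
    (a : 'I_d -> K) s :
  \sum_(t : 'S_d) one_off_eigenvalue t g h a s =
  ((d.-1)`!%:R * \sum_i a i) * (h ^+ size s - (h - g) ^+ size s).
Proof.
elim: s => [|k s IH] /=; first by rewrite big1 // subrr mulr0.
rewrite big_split -!mulr_sumr IH sum_perm_app !exprS /=. ring.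
Qed.

Lemma big_comp_foldr (V : Type) d (F : 'I_d -> V -> V) u :
  (\big[@comp V V V/idfun]_(k < d) F k) u = foldr F u (enum 'I_d).
Proof.
rewrite /index_enum unlock /= -enumT.
by elim: (enum _) => //= k s <-.
Qed.

(** For a fixed order t of the rows the column assignment r = t * s absorbs the
    sign of s up to the sign of t, which cancels the one in [alt_B_enum].  The
    remaining average over t replaces each a (t k) by its symmetric sum. *)
Lemma dEt_eigenvector (K : numFieldType) (V : lmodType K) (d : nat) (g h : K)
    (B G : 'I_d -> 'I_d -> {linear V -> V}) (x : V) (a : 'I_d -> K) :
  (0 < d)%N ->
  (forall i j u, B i j u = G i j u + (h * (i == j)%:R) *: u) ->
  (forall i j k l, G i j (G k l x) - G i l (G k j x) =
     g *: ((j == k)%:R *: G i l x - (k == l)%:R *: G i j x)) ->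
  (forall i, G i i x = (g * a i) *: x) ->
  dEt (fun i j => B i j : V -> V) x =
  ((d.-1)`!%:R * (d%:R * h ^+ d + (\sum_i a i) * (h ^+ d - (h - g) ^+ d))) *: x.
Proof.
move=> d0 BE Gc Ga; rewrite /dEt exchange_big /=.
transitivity
  (\sum_(t : 'S_d) (h ^+ d + one_off_eigenvalue t g h a (enum 'I_d)) *: x).
  apply: eq_bigr => t _.
  rewrite (reindex_inj (mulgI t^-1%g)) /=.
  apply: (@scalerI _ _ ((-1) ^+ t)); first by rewrite signr_eq0.
  rewrite -(alt_B_enum t BE Gc Ga) scaler_sumr; apply: eq_bigr => r _.
  rewrite scalerA odd_permM odd_permV signr_addb mulrA -signr_addb addbb mul1r.
  congr (_ *: _); rewrite big_comp_foldr.
  by elim: (enum _) => //= k s ->; rewrite permM permK.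
rewrite -scaler_suml big_split/= sum_one_off_eigenvalue sumr_const card_Sn.
rewrite -cardE card_ord.
have df : d`!%:R = d%:R * (d.-1)`!%:R :> K.
  by rewrite -natrM -[in (d * _)%N](prednK d0) -factS prednK.
by congr (_ *: _); rewrite -(mulr_natl (h ^+ d)) df; ring.
Qed.

(** * Multi-indices and the operators z_i d/dz_j *)

Section MultiIndex.
Variable d : nat.
Implicit Types (a b : multi_index d) (i j k l : 'I_d).

Definition mi_decr a j : multi_index d := [ffun k => (a k - (k == j))%N].
Definition mi_fact a : nat := (\prod_i (a i)`!)%N.

Lemma mi_incrK i : cancel (fun a => mi_incr a i) (fun a => mi_decr a i).
Proof. by move=> a; apply/ffunP => k; rewrite !ffunE addnK. Qed.

Lemma mi_decrK a j : (0 < a j)%N -> mi_incr (mi_decr a j) j = a.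
Proof.
move=> aj; apply/ffunP => k; rewrite !ffunE subnK//.
by have [->|] := eqVneq k j.
Qed.

Lemma mi_decrC a i j : mi_decr (mi_decr a i) j = mi_decr (mi_decr a j) i.
Proof. by apply/ffunP => k; rewrite !ffunE subnAC. Qed.

Lemma mi_decr_incr a i j : i != j ->
  mi_decr (mi_incr a i) j = mi_incr (mi_decr a j) i.
Proof.
move=> ij; apply/ffunP => k; rewrite !ffunE.
have [->|ki] := eqVneq k i; first by rewrite (negPf ij) !subn0.
by rewrite !addn0.
Qed.

Lemma mi_incr_eq a b i :
  (mi_incr a i == b) = (0 < b i)%N && (a == mi_decr b i).
Proof.
apply/eqP/andP => [<-|[bi /eqP ->]]; last exact: mi_decrK.
by rewrite mi_incrK !ffunE eqxx addn1.
Qed.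

Lemma mi_abs_incr a i : mi_abs (mi_incr a i) = (mi_abs a).+1.
Proof.
rewrite /mi_abs; under eq_bigr do rewrite ffunE.
rewrite big_split /= -[in RHS]addn1; congr (_ + _)%N.
by rewrite (bigD1 i)//= eqxx big1// => j /negPf ->.
Qed.

Lemma mi_abs_decr a i : (0 < a i)%N -> (mi_abs (mi_decr a i)).+1 = mi_abs a.
Proof. by move=> ai; rewrite -(mi_abs_incr _ i) mi_decrK. Qed.

Lemma mi_fact_incr a i : mi_fact (mi_incr a i) = ((a i).+1 * mi_fact a)%N.
Proof.
rewrite /mi_fact (bigD1 i)//= [in RHS](bigD1 i)//= !ffunE eqxx addn1 factS.
rewrite mulnA.
by congr (_ * _)%N; apply: eq_bigr => j ji; rewrite ffunE (negPf ji) addn0.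
Qed.

Lemma mi_fact_gt0 a : (0 < mi_fact a)%N.
Proof. by rewrite prodn_gt0// => i; rewrite fact_gt0. Qed.
End MultiIndex.

(** Here y_b plays the role of the monomial z^b.  Truncated subtraction in
    [mi_decr] is harmless since the coefficient b_j vanishes when b_j = 0. *)
Section PolynomialRelation.
Variables (K : numFieldType) (V : lmodType K) (d n : nat) (g : K).
Variables (y : multi_index d -> V) (G : 'I_d -> 'I_d -> {linear V -> V}).
Hypothesis Gy : forall i j b, mi_abs b = n ->
  G i j (y b) = (g * (b j)%:R) *: y (mi_incr (mi_decr b j) i).

(** Normal ordering z_i d_j z_k d_l = z_i z_k d_j d_l + [j = k] z_i d_l. *)
Lemma normal_order (a : multi_index d) i j k l : mi_abs a = n ->
  G i j (G k l (y a)) =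
  (g ^+ 2 * ((a l)%:R * ((a j)%:R - (j == l)%:R))) *:
     y (mi_incr (mi_incr (mi_decr (mi_decr a l) j) k) i) +
  (g * (j == k)%:R) *: G i l (y a).
Proof.
move=> an; rewrite !Gy// linearZ /=.
have [al0|al] := posnP (a l).
  by rewrite al0 mul0r !mulr0 !scale0r scaler0 add0r.
rewrite Gy ?mi_abs_incr ?mi_abs_decr//.
set b := mi_decr a l.
have bj : (b j)%:R = (a j)%:R - (j == l)%:R :> K.
  by rewrite /b ffunE; have [->|_] := eqVneq j l; rewrite ?subr0 ?subn0// natrB.
rewrite -bj !scalerA.
have -> : (mi_incr b k) j = (b j + (j == k))%N by rewrite ffunE.
have [jk|jk] := eqVneq j k.
  rewrite -jk mi_incrK mulr1; have [bj0|bj1] := posnP (b j).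
    rewrite bj0 !(mulr0, mul0r) scale0r add0r; congr (_ *: _).
    rewrite add0n mulr1; ring.
  by rewrite mi_decrK// -scalerDl natrD /=; congr (_ *: _); ring.
rewrite mi_decr_incr 1?eq_sym// mulr0 mul0r scale0r addr0 addn0.
by congr (_ *: _); ring.
Qed.

(** The normally ordered parts are symmetric in j and l and cancel. *)
Lemma quadratic_relation (a : multi_index d) i j k l : mi_abs a = n ->
  G i j (G k l (y a)) - G i l (G k j (y a)) =
  g *: ((j == k)%:R *: G i l (y a) - (k == l)%:R *: G i j (y a)).
Proof.
move=> an; rewrite !normal_order// mi_decrC scalerBr !scalerA [l == k]eq_sym.
rewrite opprD addrACA [X in X + _](_ : _ = 0) ?add0r//.
apply/eqP; rewrite subr_eq0; apply/eqP; congr (_ *: _); congr (_ * _).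
by rewrite [l == j]eq_sym; have [->//|_] := eqVneq j l; rewrite !subr0 mulrC.
Qed.
End PolynomialRelation.

(** * Sum of the eigenvalues *)

(** The multi-indices of degree n are the ordered partitions of n. *)
Lemma esum_level (R : realType) (m n : nat) (l : R) : 0 <= l ->
  (\esum_(a in [set a : multi_index m.+1 | mi_abs a = n]) l%:E =
   ('C(m + n, m)%:R * l)%:E)%E.
Proof.
move=> l0.
pose to_mi (t : m.+1.-tuple 'I_n.+1) : multi_index m.+1 :=
  [ffun i => val (tnth t i)].
pose A := [set t : m.+1.-tuple 'I_n.+1 | (\sum_(i <- t) i == n)%N]%SET.
have absE t : mi_abs (to_mi t) = (\sum_(i <- t) i)%N.
  by rewrite /mi_abs [RHS]big_tuple; apply: eq_bigr => i _; rewrite ffunE.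
rewrite (@reindex_esum _ _ _ [set` A] _ to_mi); last first.
  split=> [t /=|t1 t2 _ _ /ffunP e|a /= an].
  - by rewrite inE absE => /eqP.
  - by apply: eq_from_tnth => i; apply: val_inj; have := e i; rewrite !ffunE.
  have ale i : (a i < n.+1)%N.
    by rewrite ltnS -an /mi_abs (bigD1 i)//= leq_addr.
  have ta : to_mi [tuple Ordinal (ale i) | i < m.+1] = a.
    by apply/ffunP => i; rewrite ffunE tnth_mktuple.
  by exists [tuple Ordinal (ale i) | i < m.+1]; rewrite //= inE -absE ta an.
rewrite esum_fset//.
have -> : [set` A] = [set` enum A].
  by apply/seteqP; split=> t /=; rewrite mem_enum.
rewrite -fsbig_seq ?enum_uniq// sumEFin big_const_seq count_predT -cardE.
by rewrite card_ord_partitions iter_addr_0 mulr_natl.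
Qed.

(** Bernoulli's inequality (1 - 1 / (M + 1)) ^ (m + 1) >= 1 - (m + 1) / (M + 1),
    cleared of denominators. *)
Lemma bernoulli_nat M m : (m <= M)%N -> ((M - m) * M.+1 ^ m <= M ^ m.+1)%N.
Proof.
elim: m => [|m IH] mM; first by rewrite subn0 !expn0 muln1.
have {}IH := IH (ltnW mM).
rewrite [(M ^ _)%N]expnS [(M.+1 ^ _)%N]expnS.
apply: leq_trans (_ : (M * ((M - m) * M.+1 ^ m) <= _)%N); last first.
  by rewrite leq_mul2l IH orbT.
rewrite !mulnA leq_mul2r; apply/orP; right.
have -> : M = (m.+1 + (M - m.+1))%N by rewrite subnKC.
set k := (M - m.+1)%N; nia.
Qed.

Lemma ffact_le N d : (N ^_ d <= N ^ d)%N.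
Proof.
rewrite ffact_prod -[d in (_ ^ d)%N]card_ord -prod_nat_const.
by apply: leq_prod => i _; rewrite leq_subr.
Qed.

Lemma ffact_ge n d : (n ^ d <= (n + d) ^_ d)%N.
Proof.
rewrite ffact_prod -[d in (_ ^ d)%N]card_ord -prod_nat_const.
by apply: leq_prod => i _; have := ltn_ord i; lia.
Qed.

Section Weights.
Variables (R : realType) (m : nat) (delta : nat -> R).
Local Notation d := m.+1.
Hypothesis delta_gt0 : forall n, 0 < delta n.
Hypothesis delta_incr : nondecreasing_seq delta.
Hypothesis delta_lim : delta n @[n --> \oo] --> (1 : R).

Definition up_weight n : R := delta n ^+ 2 / (n + d)%:R.
(** In degree 0 the value is arbitrary: it only occurs multiplied by n or by a
    component of a multi-index of degree n. *)
Definition down_weight n : R := delta n.-1 ^+ 2 / (n.-1 + d)%:R.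
Definition dEt_eigenvalue n : R :=
  (d.-1)`!%:R * (d%:R * up_weight n ^+ d +
    n%:R * (up_weight n ^+ d - down_weight n ^+ d)).

(** As delta_(n-1) <= delta_n, it suffices to treat a constant delta, where the
    claim n (n + d) ^ d <= (n + d) (n + d - 1) ^ d is Bernoulli's inequality. *)
Lemma dEt_eigenvalue_ge0 n : 0 <= dEt_eigenvalue n.
Proof.
rewrite /dEt_eigenvalue mulr_ge0// mulrBr addrA -mulrDl subr_ge0.
case: n => [|n].
  by rewrite mul0r addr0 mulr_ge0// exprn_ge0// divr_ge0// sqr_ge0.
have dle : down_weight n.+1 <= delta n.+1 ^+ 2 / (n + d)%:R.
  rewrite ler_wpM2r ?invr_ge0//.
  by rewrite ler_sqr ?nnegrE ?(ltW (delta_gt0 _))//; exact: delta_incr.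
have p0 : 0 <= down_weight n.+1 by rewrite divr_ge0// sqr_ge0.
apply: le_trans (ler_wpM2l (ler0n _ _) (lerXn2r _ _ _ dle)) _;
  rewrite ?nnegrE//.
  exact: le_trans dle.
rewrite /up_weight !expr_div_n mulrCA [leRHS]mulrCA.
rewrite ler_wpM2l ?exprn_ge0 ?(ltW (delta_gt0 _))//.
rewrite ler_pdivrMr ?exprn_gt0 ?ltr0n ?addnS// mulrAC.
rewrite ler_pdivlMr ?exprn_gt0 ?ltr0n//.
rewrite -natrD -!natrX -!natrM ler_nat.
have := bernoulli_nat (leq_addl n.+1 m); rewrite addnK => b.
have -> : (d + n.+1 = (n.+1 + m).+1)%N by lia.
by rewrite [X in (_ * X <= _)%N]expnS mulnCA leq_mul2l b.
Qed.

(** The multiplicity of the eigenvalue makes the sum over the degrees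
    telescope. *)
Lemma dEt_eigenvalue_level n :
  'C(m + n, m)%:R * dEt_eigenvalue n =
  ((n.+1 + m) ^_ d)%:R * down_weight n.+1 ^+ d -
  ((n + m) ^_ d)%:R * down_weight n ^+ d.
Proof.
have fC : 'C(m + n, m)%:R * (m`!)%:R = ((m + n) ^_ m)%:R :> R.
  by rewrite -natrM bin_ffact.
have hE : down_weight n.+1 = up_weight n by [].
rewrite hE /dEt_eigenvalue mulrA fC addSn ffactSS ffactnSr.
rewrite [(m + n)%N]addnC addnK !natrM.
ring.
Qed.

Lemma total_weight_lim :
  ((n + m) ^_ d)%:R * down_weight n ^+ d @[n --> \oo] --> (1 : R).
Proof.
rewrite -(cvg_shiftS _) /=.
have -> : (fun n => ((n.+1 + m) ^_ d)%:R * down_weight n.+1 ^+ d) =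
    (fun n => ((n + d) ^_ d)%:R / (n + d)%:R ^+ d * (delta n ^+ 2) ^+ d).
  apply/funext => n; rewrite /down_weight /= addSnnS expr_div_n; ring.
have cdelta : (delta n ^+ 2) ^+ d @[n --> \oo] --> (1 : R).
  under eq_fun do rewrite -exprM.
  have := cvg_comp _ _ delta_lim (@exprn_continuous R (2 * d) 1).
  by rewrite expr1n.
have cratio : n%:R / (n + d)%:R @[n --> \oo] --> (1 : R).
  have cd : (n + d)%:R^-1 @[n --> \oo] --> (0 : R).
    apply: (squeeze_cvgr _ (cvg_cst 0) (@cvg_harmonic R)); near=> n.
    rewrite invr_ge0 ler0n /= lef_pV2 ?posrE ?ltr0n ?addnS//.
    by rewrite ler_nat ltnS leq_addr.
  have -> : (fun n => n%:R / (n + d)%:R : R) =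
      (fun n => 1 - d%:R * (n + d)%:R^-1).
    apply/funext => n; rewrite -[n in n%:R / _](addnK d) natrB ?leq_addl//.
    by rewrite mulrBl divff// pnatr_eq0 addnS.
  have := cvgB (cvg_cst (1 : R)) (cvgM (cvg_cst (d%:R : R)) cd).
  by rewrite mulr0 subr0; apply.
have cpow : (n%:R / (n + d)%:R) ^+ d @[n --> \oo] --> (1 : R).
  by have := cvg_comp _ _ cratio (@exprn_continuous R d 1); rewrite expr1n.
have cffact : ((n + d) ^_ d)%:R / (n + d)%:R ^+ d @[n --> \oo] --> (1 : R).
  apply: (squeeze_cvgr _ cpow); last exact: cvg_cst.
  near=> n.
  have nd : 0 < (n + d)%:R ^+ d :> R by rewrite exprn_gt0// ltr0n addnS.
  rewrite expr_div_n ler_pM2r ?invr_gt0// ler_pdivrMr// mul1r -!natrX !ler_nat.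
  by rewrite ffact_ge ffact_le.
by have := cvgM cffact cdelta; rewrite mulr1; apply.
Unshelve. all: by end_near.
Qed.

Lemma esum_dEt_eigenvalue :
  (\esum_(a in [set: multi_index d]) (dEt_eigenvalue (mi_abs a))%:E = 1%:E)%E.
Proof.
pose L n := [set a : multi_index d | mi_abs a = n].
have -> : [set: multi_index d] = \bigcup_n L n.
  by apply/seteqP; split=> a // _; exists (mi_abs a).
rewrite nneseries_sum_bigcup.
- have E n : (\esum_(a in L n) (dEt_eigenvalue (mi_abs a))%:E =
      ('C(m + n, m)%:R * dEt_eigenvalue n)%:E)%E.
    rewrite -esum_level ?dEt_eigenvalue_ge0//.
    by apply: eq_esum => a /= ->; exact: erefl.
  under eq_eseriesr do rewrite E.
  apply/cvg_lim => //.
  under eq_fun do rewrite sumEFin.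
  apply: cvg_EFin; first exact: nearW.
  have -> : fine \o
      (fun n => (\sum_(0 <= i < n) 'C(m + i, m)%:R * dEt_eigenvalue i)%:E) =
     (fun n => ((n + m) ^_ d)%:R * down_weight n ^+ d).
    apply/funext => n /=; under eq_bigr do rewrite dEt_eigenvalue_level.
    rewrite telescope_sumr// [(0 + m)%N]add0n [m ^_ d]ffact_small//.
    by rewrite mul0r subr0.
  exact: total_weight_lim.
- by move=> i j _ _ [a [<- <-]].
- by move=> a; rewrite lee_fin dEt_eigenvalue_ge0.
Qed.
End Weights.

(** * Bounded operators and orthonormal bases *)

Lemma norm_arbitrarily_small (K : numFieldType) (V : normedZmodType K) (z : V) :
  (forall e : K, 0 < e -> `|z| <= e) -> z = 0.
Proof.
move=> ze; apply/eqP; rewrite -normr_eq0; apply/negPn/negP => z0.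
have zp : 0 < `|z| by rewrite lt_def z0 normr_ge0.
have /ze : 0 < `|z| / 2 by rewrite divr_gt0.
have h : `|z| / 2 < `|z| by rewrite ltr_pdivrMr// mulr_natr mulr2n ltrDl.
by move/le_lt_trans => /(_ _ h); rewrite ltxx.
Qed.

(** The order of K is partial: z is shown to be nonnegative by z = `|z|. *)
Lemma ge0_approx (K : numFieldType) (z : K) :
  (forall e : K, 0 < e -> exists2 s, 0 <= s & `|z - s| <= e) -> 0 <= z.
Proof.
move=> zs; rewrite -[z](subrK `|z|) (_ : z - `|z| = 0) ?add0r//.
apply: norm_arbitrarily_small => e e0.
have [s s0 zse] := zs (e / 2) (divr_gt0 e0 (ltr0n _ 2)).
rewrite (_ : z - `|z| = (z - s) + (s - `|z|)); last by rewrite addrA subrK.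
rewrite (le_trans (ler_normD _ _))// [e]splitr lerD// (le_trans _ zse)//.
by rewrite -{1}(ger0_norm s0) (distrC z) ler_dist_dist.
Qed.

Lemma conj_real (R : realType) (a : R) : Num.conj a%:C = a%:C :> R[i].
Proof. by apply/CrealP; rewrite complex_real. Qed.

(** The squared modulus as an element of R, as the sums of nonnegative terms
    below are taken in the extended reals. *)
Definition sqmod (R : realType) (z : R[i]) : R := complex.Re (`|z| ^+ 2).

Lemma sqmodE (R : realType) (z : R[i]) : (sqmod z)%:C = `|z| ^+ 2.
Proof. by rewrite RRe_real// rpredX// normr_real. Qed.

Lemma sqmod_ge0 (R : realType) (z : R[i]) : 0 <= sqmod z.
Proof. by rewrite -lecR sqmodE exprn_ge0. Qed.

Section Hilbert.
Variables (R : realType) (H : completeNormedModType R[i]).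
Variables (ip : inner_product H) (Hip : induces_norm ip).
Local Notation K := R[i].
Implicit Types (u v w : H) (A : H -> H).

Lemma ipC u v : ip u v = Num.conj (ip v u).
Proof. by rewrite (hermC ip) expr0 mul1r. Qed.

Lemma ipDl u v w : ip (u + v) w = ip u w + ip v w.
Proof. exact: linearDl. Qed.
Lemma ipDr u v w : ip w (u + v) = ip w u + ip w v.
Proof. exact: linearDr. Qed.
Lemma ipBl u v w : ip (u - v) w = ip u w - ip v w.
Proof. exact: linearBl. Qed.
Lemma ipBr u v w : ip w (u - v) = ip w u - ip w v.
Proof. exact: linearBr. Qed.
Lemma ipZl a u v : ip (a *: u) v = a * ip u v.
Proof. exact: linearZl_LR. Qed.
Lemma ipZr a u v : ip u (a *: v) = Num.conj a * ip u v.
Proof. exact: linearZr_LR. Qed.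
Lemma ip0r u : ip u 0 = 0. Proof. exact: linear0r. Qed.
Lemma ip_suml (I : Type) (s : seq I) (f : I -> H) v :
  ip (\sum_(i <- s) f i) v = \sum_(i <- s) ip (f i) v.
Proof. exact: linear_sumlz. Qed.
Lemma ip_sumr (I : Type) (s : seq I) (f : I -> H) v :
  ip v (\sum_(i <- s) f i) = \sum_(i <- s) ip v (f i).
Proof. exact: linear_sumr. Qed.

Lemma pythagoras u v : ip u v = 0 -> `|u + v| ^+ 2 = `|u| ^+ 2 + `|v| ^+ 2.
Proof. by move=> uv; rewrite -!Hip (hnormDd uv). Qed.

Lemma cauchy_schwarz u v : `|ip u v| <= `|u| * `|v|.
Proof.
rewrite -(@ler_pXn2r _ 2) ?nnegrE ?mulr_ge0// exprMn.
have [->|v0] := eqVneq v 0; first by rewrite ip0r !normr0 expr0n mulr0.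
have nv : 0 < `|v| ^+ 2 by rewrite exprn_gt0 ?normr_gt0.
pose a := ip u v / `|v| ^+ 2.
have ov : ip (u - a *: v) (a *: v) = 0.
  by rewrite ipZr ipBl ipZl Hip /a divfK ?gt_eqF// subrr mulr0.
rewrite -[X in _ <= `|X| ^+ 2 * _](subrK (a *: v)) pythagoras// mulrDl.
have -> : `|a *: v| ^+ 2 * `|v| ^+ 2 = `|ip u v| ^+ 2.
  rewrite normrZ /a normrM normfV normrX normr_id.
  by field; rewrite normr_eq0.
by rewrite lerDr mulr_ge0.
Qed.

Lemma bounded_operator_bound A : bounded_operator A ->
  exists2 M : K, 0 < M & forall u, `|A u| <= M * `|u|.
Proof.
move=> [linA cA].
pose A' : {linear H -> H} := HB.pack A (GRing.isLinear.Build _ _ _ _ A linA).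
have /linear_bounded_continuous/linear_boundedP/pinfty_ex_gt0 [M M0 AM] :
  continuous A' by [].
by exists M.
Qed.

Lemma bound_bounded_operator A (M : K) : 0 < M -> linear A ->
  (forall u, `|A u| <= M * `|u|) -> bounded_operator A.
Proof.
move=> M0 linA AM; split=> //.
pose A' : {linear H -> H} := HB.pack A (GRing.isLinear.Build _ _ _ _ A linA).
have : bounded_near A' (nbhs 0); last by move/linear_bounded_continuous.
apply/linear_boundedP; near=> r => u; rewrite (le_trans (AM u))//.
rewrite ler_wpM2r//; near: r; apply: nbhs_pinfty_ge.
exact: gtr0_real.
Unshelve. all: by end_near. Qed.

Lemma eq_of_ip_eq v w : (forall u, ip u v = ip u w) -> v = w.
Proof.
move=> vw; apply/eqP; rewrite -subr_eq0 -normr_eq0 -sqrf_eq0 -Hip.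
by rewrite ipBr vw subrr.
Qed.

Lemma closure_approx (S : set H) v (e : K) : closure S v -> 0 < e ->
  exists2 s, S s & `|v - s| < e.
Proof.
move=> Sv e0; have [s [Ss]] := Sv _ (nbhsx_ballx v e e0).
by rewrite -ball_normE /=; exists s.
Qed.

(** The representing vectors depend on v in a Lipschitz way, so they form a
    Cauchy filter along approximations of v; this is where completeness of the
    space enters. *)
Lemma has_adjoint_closed A : bounded_operator A ->
  closed [set v | exists w, forall u, ip (A u) v = ip u w].
Proof.
move=> Ab; have [M M0 AM] := bounded_operator_bound Ab.
set D := [set v | _] => v /= clv.
have /choice [f fP] : forall v', exists w,
    D v' -> forall u, ip (A u) v' = ip u w.
  move=> v'; have [[w ww]|nD] := pselect (D v'); first by exists w.
  by exists 0.
have lipf v1 v2 : D v1 -> D v2 -> `|f v1 - f v2| <= M * `|v1 - v2|.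
  move=> D1 D2; set w := f v1 - f v2.
  have [->|w0] := eqVneq w 0; first by rewrite normr0 mulr_ge0// ltW.
  rewrite -(ler_pM2l (x := `|w|)) ?normr_gt0// -expr2 -Hip {2}/w ipBr.
  rewrite -!fP// -ipBr.
  have -> : ip (A w) (v1 - v2) = `|ip (A w) (v1 - v2)|.
    by rewrite ger0_norm// ipBr !fP// -ipBr Hip exprn_ge0.
  rewrite (le_trans (cauchy_schwarz _ _))// mulrA ler_wpM2r//.
  by rewrite (le_trans (AM w))// mulrC.
pose F := within D (nbhs v).
have FF : ProperFilter F by apply: within_nbhs_proper.
have nearF e : 0 < e -> F [set v' | D v' /\ `|v - v'| < e].
  move=> e0; apply: filterS (nbhsx_ballx v e e0) => v' vv' Dv'.
  by rewrite -ball_normE in vv'.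
have : cauchy (f @ F).
  apply/cauchy_exP => e e0.
  have e1 : 0 < e / (M * 2) by rewrite divr_gt0// mulr_gt0.
  have [v1 [D1 v1e]] := filter_ex (nearF _ e1).
  exists (f v1); rewrite /= nbhs_simpl /=.
  apply: filterS (nearF _ e1) => v2 [D2 v2e]; rewrite -ball_normE /=.
  rewrite (le_lt_trans (lipf _ _ D1 D2))//.
  rewrite -ltr_pdivlMl// (_ : v1 - v2 = (v1 - v) + (v - v2)); last first.
    by rewrite addrA subrK.
  rewrite (le_lt_trans (ler_normD _ _))// distrC.
  rewrite (_ : _ * e = e / (M * 2) + e / (M * 2)) ?ltrD//.
  by field; rewrite gt_eqF.
move/cauchy_cvg => /cvg_ex[w fw]; exists w => u.
apply/eqP; rewrite -subr_eq0; apply/eqP/norm_arbitrarily_small => e e0.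
pose c := `|A u| + `|u| + 1.
have c0 : 0 < c by rewrite ltr_wpDl// addr_ge0.
have ec : 0 < e / c by rewrite divr_gt0.
have fwe : F [set v' | `|w - f v'| < e / c].
  by move/cvgrPdist_lt : fw => /(_ _ ec).
have [v' [[Dv' ve]] /= we] := filter_ex (filterI (nearF _ ec) fwe).
rewrite (_ : _ - _ = ip (A u) (v - v') - ip u (w - f v')); last first.
  by rewrite !ipBr (fP v' Dv') opprB addrA subrK.
rewrite (le_trans (ler_normB _ _))//.
rewrite (le_trans (lerD (cauchy_schwarz _ _) (cauchy_schwarz _ _)))//.
rewrite (le_trans (lerD (ler_wpM2l _ (ltW ve)) (ler_wpM2l _ (ltW we))))//.
rewrite -mulrDl mulrA ler_pdivrMr// mulrC ler_wpM2l ?ltW//.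
by rewrite /c ltrDl.
Qed.

Lemma adjoint_unique A B : (forall u v, ip (A u) v = ip u (B v)) ->
  adjoint ip A = B.
Proof.
move=> AB; have : [set B : H -> H | forall u v, ip (A u) v = ip u (B v)] !=set0.
  by exists B.
move/getPex => /= h; apply/funext => v; apply: eq_of_ip_eq => u.
by rewrite -h AB.
Qed.

Lemma adjoint_bounded A : bounded_operator A ->
  (forall u v, ip (A u) v = ip u (adjoint ip A v)) ->
  bounded_operator (adjoint ip A).
Proof.
move=> Ab AB; have [M M0 AM] := bounded_operator_bound Ab.
apply: (bound_bounded_operator M0).
  move=> a v1 v2; apply: eq_of_ip_eq => u.
  by rewrite ipDr ipZr -!AB ipDr ipZr.
move=> v; set w := adjoint ip A v.
have [->|w0] := eqVneq w 0; first by rewrite normr0 mulr_ge0// ltW.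
rewrite -(ler_pM2l (x := `|w|)) ?normr_gt0// -expr2 -Hip {2}/w -AB.
have -> : ip (A w) v = `|ip (A w) v|.
  by rewrite ger0_norm// AB Hip exprn_ge0.
rewrite (le_trans (cauchy_schwarz _ _))// mulrA ler_wpM2r//.
by rewrite (le_trans (AM w))// mulrC.
Qed.

Lemma bounded_operatorZ A (c : K) u :
  bounded_operator A -> A (c *: u) = c *: A u.
Proof.
move=> [linA _].
pose A' : {linear H -> H} := HB.pack A (GRing.isLinear.Build _ _ _ _ A linA).
exact: (linearZZ A' c u).
Qed.

Lemma bounded_comp A B : bounded_operator A -> bounded_operator B ->
  bounded_operator (A \o B).
Proof.
move=> [lA cA] [lB cB]; split; first by move=> a u v; rewrite /= lB lA.
by move=> u; apply: continuous_comp; [exact: cB|exact: cA].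
Qed.

Lemma bounded_sub A B : bounded_operator A -> bounded_operator B ->
  bounded_operator (fun u => A u - B u).
Proof.
move=> [lA cA] [lB cB]; split.
  by move=> a u v; rewrite lA lB scalerBr opprD addrACA.
by move=> u; apply: cvgB; [exact: cA|exact: cB].
Qed.

Lemma bounded_scale (c : K) A : bounded_operator A ->
  bounded_operator (fun u => c *: A u).
Proof.
move=> [lA cA]; split.
  by move=> a u v; rewrite lA scalerDr !scalerA mulrC.
by move=> u; apply: cvgZl_tmp; exact: cA.
Qed.

Lemma bounded_sum (I : Type) (s : seq I) (F : I -> H -> H) :
  (forall i, bounded_operator (F i)) ->
  bounded_operator (fun u => \sum_(i <- s) F i u).
Proof.
move=> Fb; elim: s => [|i s [ls cs]].
  under [fun=> _]eq_fun do rewrite big_nil.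
  split; first by move=> a u v; rewrite scaler0 addr0.
  by move=> u; exact: cvg_cst.
have [li ci] := Fb i.
under [fun=> _]eq_fun do rewrite big_cons.
split; first by move=> a u v; rewrite ls li scalerDr addrACA.
by move=> u; apply: cvgD; [exact: ci|exact: cs].
Qed.

Lemma bounded_dEt d (B : 'I_d -> 'I_d -> H -> H) :
  (forall i j, bounded_operator (B i j)) -> bounded_operator (dEt B).
Proof.
move=> Bb; rewrite /dEt; apply: bounded_sum => s; apply: bounded_sum => t.
apply: bounded_scale; elim/big_ind : _ => //.
  by split=> [a u v //|u]; exact: cvg_id.
by move=> f g; exact: bounded_comp.
Qed.

Section Basis.
Variables (I : choiceType) (e : I -> H).
Hypothesis e_orth : forall i j, ip (e i) (e j) = (i == j)%:R.
Hypothesis e_total : closure (lin_span e) = [set: H].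

Lemma ip_eq_on_basis A v w : bounded_operator A ->
  (forall i, ip (A (e i)) v = ip (e i) w) -> forall u, ip (A u) v = ip u w.
Proof.
move=> Ab Ae u; have [M M0 AM] := bounded_operator_bound Ab.
have [linA _] := Ab.
pose A' : {linear H -> H} := HB.pack A (GRing.isLinear.Build _ _ _ _ A linA).
apply/eqP; rewrite -subr_eq0; apply/eqP/norm_arbitrarily_small => eps eps0.
pose c := M * `|v| + `|w| + 1.
have c0 : 0 < c by rewrite ltr_wpDl// addr_ge0// mulr_ge0// ltW.
have : closure (lin_span e) u by rewrite e_total.
move=> /closure_approx/(_ (divr_gt0 eps0 c0))[_ [s [a ->]]].
set y := \sum_(i <- s) _ => uy.
have Ay : ip (A y) v = ip y w.
  rewrite -[A y]/(A' y) linear_sum !ip_suml; apply: eq_bigr => i _.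
  by rewrite linearZ !ipZl Ae.
have -> : ip (A u) v - ip u w = ip (A' (u - y)) v - ip (u - y) w.
  by rewrite linearB !ipBl /= Ay opprB addrA subrK.
rewrite (le_trans (ler_normB _ _))//.
rewrite (le_trans (lerD (cauchy_schwarz _ _) (cauchy_schwarz _ _)))//.
rewrite (le_trans (lerD (ler_wpM2r _ (AM _)) (lexx _)))//.
rewrite mulrAC [X in _ + X]mulrC -mulrDl.
have c1 : 0 <= M * `|v| + `|w| by rewrite addr_ge0// mulr_ge0// ltW.
rewrite (le_trans (ler_wpM2l c1 (ltW uy)))//.
by rewrite mulrA ler_pdivrMr// mulrC ler_pM2l// /c lerDl.
Qed.

(** Vectors that are represented form a closed subspace by
    [has_adjoint_closed]; so it is enough to exhibit the value of the adjoint on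
    an orthonormal basis. *)
Lemma adjointE A :
  bounded_operator A ->
  (forall i, exists w, forall u, ip (A u) (e i) = ip u w) ->
  forall u v, ip (A u) v = ip u (adjoint ip A v).
Proof.
move=> Ab /choice[w we].
have /choice [B BP] : forall v, exists w, forall u, ip (A u) v = ip u w.
  move=> v; apply: (has_adjoint_closed Ab).
  have : closure (lin_span e) v by rewrite e_total.
  apply: closureS => _ [s [a ->]]; exists (\sum_(i <- s) a i *: w i) => u.
  by rewrite !ip_sumr; apply: eq_bigr => i _; rewrite !ipZr we.
have : [set B : H -> H | forall u v, ip (A u) v = ip u (B v)] !=set0.
  by exists B => u v; exact: BP.
by move/getPex => /= h u v; apply: h.
Qed.

Definition orth_proj (F : {fset I}) u : H := \sum_(i <- F) ip u (e i) *: e i.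

Lemma orth_proj_orth F u i : i \in F -> ip (u - orth_proj F u) (e i) = 0.
Proof.
move=> iF; rewrite ipBl ip_suml (bigD1_seq i)//= ipZl e_orth eqxx mulr1.
rewrite big1 ?addr0 ?subrr// => j ji.
by rewrite ipZl e_orth (negPf ji) mulr0.
Qed.

Lemma ip_orth_proj F u (s : seq I) (a : I -> K) : {subset s <= F} ->
  ip (u - orth_proj F u) (\sum_(i <- s) a i *: e i) = 0.
Proof.
move=> sF; rewrite ip_sumr big_seq big1// => i si.
by rewrite ipZr orth_proj_orth ?mulr0// sF.
Qed.

Lemma bessel (F : {fset I}) u :
  `|u| ^+ 2 = \sum_(i <- F) `|ip u (e i)| ^+ 2 + `|u - orth_proj F u| ^+ 2.
Proof.
have o : ip (u - orth_proj F u) (orth_proj F u) = 0 by exact: ip_orth_proj.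
rewrite -{1}(subrK (orth_proj F u) u) (pythagoras o) addrC; congr (_ + _).
rewrite -Hip {1}/orth_proj ip_suml; apply: eq_big_seq => i iF.
have /eqP := orth_proj_orth u iF; rewrite ipBl subr_eq0 => /eqP ue.
by rewrite ipZl [ip (e i) _]ipC -ue normCK.
Qed.

(** Among the combinations of e_i with i in F the projection is the closest to
    u, and some finite combination is close to u by totality. *)
Lemma orth_proj_approx u (eps : K) : 0 < eps ->
  exists F0 : {fset I}, forall F, (F0 `<=` F)%fset ->
    `|u - orth_proj F u| < eps.
Proof.
move=> eps0; have : closure (lin_span e) u by rewrite e_total.
move=> /closure_approx/(_ eps0)[_ [s [a ->]]].
set y := \sum_(i <- s) _ => uy.
exists [fset i in s]%fset => F /fsubsetP sF; apply: le_lt_trans uy.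
rewrite -(@ler_pXn2r _ 2) ?nnegrE//.
have -> : u - y = (u - orth_proj F u) + (orth_proj F u - y).
  by rewrite addrA subrK.
rewrite [leRHS]pythagoras ?lerDl ?exprn_ge0// ipBr ip_orth_proj//.
by rewrite ip_orth_proj ?subrr// => i si; apply: sF; rewrite inE.
Qed.

Section Diagonal.
Variables (P : H -> H) (c : I -> R).
Hypothesis Pb : bounded_operator P.
Hypothesis Pe : forall i, P (e i) = (c i)%:C *: e i.

Lemma diagonal_ip u i : ip (P u) (e i) = (c i)%:C * ip u (e i).
Proof.
have conj_c : Num.conj (c i)%:C = (c i)%:C :> K := conj_real _.
rewrite -conj_c -ipZr; apply: ip_eq_on_basis => // j.
rewrite Pe ipZl ipZr conj_c e_orth.
by have [->//|_] := eqVneq j i; rewrite !mulr0.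
Qed.

Lemma diagonal_selfadjoint u v : ip (P u) v = ip u (P v).
Proof.
apply: ip_eq_on_basis => // i.
have conj_c : Num.conj (c i)%:C = (c i)%:C :> K := conj_real _.
by rewrite Pe ipZl [RHS]ipC diagonal_ip rmorphM/= conj_c -ipC.
Qed.

(** P preserves both the span of the e_i with i in F and its orthogonal
    complement, so the cross terms vanish. *)
Lemma diagonal_quadratic (F : {fset I}) u :
  ip (P u) u = (\sum_(i <- F) c i * sqmod (ip u (e i)))%:C +
    ip (P (u - orth_proj F u)) (u - orth_proj F u).
Proof.
set p := orth_proj F u; set r := u - p.
have [linP _] := Pb.
pose P' : {linear H -> H} := HB.pack P (GRing.isLinear.Build _ _ _ _ P linP).
have Pp : P p = \sum_(i <- F) ((c i)%:C * ip u (e i)) *: e i.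
  rewrite -[P p]/(P' p) linear_sum; apply: eq_bigr => i _.
  by rewrite linearZ /= Pe scalerA mulrC.
have rPp : ip r (P p) = 0 by rewrite Pp ip_orth_proj.
have PD : P (r + p) = P r + P p := linearD P' r p.
have pPr : ip (P p) r = 0 by rewrite ipC rPp rmorph0.
have -> : ip (P u) u = ip (P p) p + ip (P r) r.
  have ur : u = r + p by rewrite subrK.
  clearbody r p; rewrite ur PD ipDl !ipDr (diagonal_selfadjoint r p).
  by rewrite rPp pPr addr0 add0r addrC.
congr (_ + _).
rewrite Pp ip_suml rmorph_sum; apply: eq_big_seq => i iF.
have /eqP := orth_proj_orth u iF; rewrite ipBl subr_eq0 -/p => /eqP ue.
rewrite ipZl [ip (e i) _]ipC -ue -mulrA -normCK rmorphM /=; congr (_ * _).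
by rewrite sqmodE.
Qed.
End Diagonal.
End Basis.
End Hilbert.

Section NonnegativeSums.
Variables (R : realType) (I : choiceType) (f : I -> R) (t : R).
Hypothesis f0 : forall i, 0 <= f i.

Lemma le_sum_esum (F : {fset I}) :
  ((\sum_(i <- F) f i)%:E <= \esum_(i in [set: I]) (f i)%:E)%E.
Proof.
apply: esum_ge; exists [set` F]; first by split=> //; exact: finite_fset.
by rewrite fsbig_finite//= set_fsetK sumEFin.
Qed.

Lemma esum_eqP : (\esum_(i in [set: I]) (f i)%:E = t%:E)%E <->
  (forall F : {fset I}, \sum_(i <- F) f i <= t) /\
  (forall eps, 0 < eps -> exists F : {fset I}, t - eps <= \sum_(i <- F) f i).
Proof.
split=> [ft|[ub lb]].
  split=> [F|eps eps0]; first by rewrite -lee_fin -ft le_sum_esum.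
  have : (ereal_sup [set (\sum_(x \in A) (f x)%:E)%E | A in fsets [set: I]]
      \is a fin_num) by rewrite -[ereal_sup _]/(esum _ _) ft.
  move=> /(ub_ereal_sup_adherent eps0)[_ [A [finA _] <-]].
  rewrite -[ereal_sup _]/(esum _ _) ft fsbig_finite//= sumEFin => h.
  by exists (fset_set A); rewrite ltW// -lte_fin EFinB.
apply/eqP; rewrite eq_le; apply/andP; split.
  apply: ge_ereal_sup => _ [A [finA _] <-].
  by rewrite fsbig_finite//= sumEFin lee_fin ub.
apply/lee_addgt0Pr => eps eps0; have [F tF] := lb _ eps0.
rewrite -leeBlDr//; apply: le_trans (le_sum_esum F).
by rewrite -EFinB lee_fin.
Qed.

Lemma esum_partial_sum : (\esum_(i in [set: I]) (f i)%:E = t%:E)%E ->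
  partial_sum (fun i => (f i)%:C) @ totally --> (t%:C : R[i]^o).
Proof.
have totallyF : Filter (@totally I) by exact: totally_filter.
move=> /esum_eqP[ub lb].
have [_] := @cvgrPdist_le R[i] R[i]^o _ _ totallyF
  (partial_sum (fun i => (f i)%:C)) t%:C.
apply=> e e0.
have /complex_realP[eps epsE] := gtr0_real e0.
have eps0 : 0 < eps by rewrite -ltcR -epsE.
have [F0 tF0] := lb _ eps0.
exists F0 => // F /= /fsubsetP F0F.
have -> : partial_sum (fun i => (f i)%:C) F = (\sum_(i <- F) f i)%:C.
  rewrite /partial_sum -(big_seq_fsetE _ F xpredT (fun i => (f i)%:C)) /=.
  by rewrite rmorph_sum.
rewrite -rmorphB /= epsE ger0_norm ?lecR ?ler0c ?subr_ge0 ?ub//.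
rewrite lerBlDl -lerBlDr (le_trans tF0)//.
rewrite [leRHS](big_fsetID _ (mem F0))/=.
have -> : [fset i in F | i \in F0]%fset = F0.
  apply/fsetP => i; rewrite !inE.
  by case: (boolP (i \in F0)) => [/F0F ->|]; rewrite ?andbF.
by rewrite lerDl sumr_ge0.
Qed.
End NonnegativeSums.

Lemma esumZl_real (R : realType) (I : choiceType) (f : I -> R) (c t : R) :
  (forall i, 0 <= f i) -> 0 <= c ->
  (\esum_(i in [set: I]) (f i)%:E = t%:E)%E ->
  (\esum_(i in [set: I]) (c * f i)%:E = (c * t)%:E)%E.
Proof.
move=> f0 c0 /esum_eqP[ub lb].
have [->|cn0] := eqVneq c 0.
  by rewrite mul0r esum1// => i _; rewrite mul0r.
have cp : 0 < c by rewrite lt_def cn0.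
apply/esum_eqP.
split=> [F|eps eps0]; first by rewrite -mulr_sumr ler_wpM2l.
have [F Ft] := lb _ (divr_gt0 eps0 cp); exists F.
by rewrite -mulr_sumr -ler_pdivrMl// mulrBr mulKf// mulrC.
Qed.

Lemma exchange_esum (R : realType) (I J : choiceType) (a : I -> J -> \bar R) :
  (forall i j, 0 <= a i j)%E ->
  (\esum_(i in [set: I]) \esum_(j in [set: J]) a i j =
   \esum_(j in [set: J]) \esum_(i in [set: I]) a i j)%E.
Proof.
move=> a0; rewrite !esum_esum//.
rewrite (@reindex_esum _ _ _ ([set: J] `*`` fun=> [set: I]) _
  (fun p => (p.2, p.1)))//.
split=> [p _ //|p q _ _ /= [p1 p2]|[i j] _]; last by exists (j, i).
by case: p q p1 p2 => [? ?] [? ?] /= -> ->.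
Qed.

Section Trace.
Variables (R : realType) (H : completeNormedModType R[i]).
Variables (ip : inner_product H) (Hip : induces_norm ip).
Local Notation K := R[i].

Lemma parseval (I : choiceType) (e : I -> H) u : orthonormal_basis ip e ->
  (\esum_(i in [set: I]) (sqmod (ip u (e i)))%:E = (sqmod `|u|)%:E)%E.
Proof.
move=> [e_orth e_total]; apply/esum_eqP.
have bes (F : {fset I}) : (sqmod `|u|)%:C =
    (\sum_(i <- F) sqmod (ip u (e i)))%:C + `|u - orth_proj ip e F u| ^+ 2.
  rewrite sqmodE normr_id (bessel Hip e_orth F) rmorph_sum; congr (_ + _).
  by apply: eq_bigr => i _; rewrite /= sqmodE.
split=> [F|eps eps0]; first by rewrite -lecR (bes F) lerDl exprn_ge0.
have eps1 : 0 < (Num.sqrt eps)%:C :> K by rewrite ltcR sqrtr_gt0.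
have [F0 F0u] := orth_proj_approx Hip e_orth e_total u eps1.
exists F0; rewrite lerBlDr -lecR (bes F0) rmorphD /= lerD2l.
rewrite -(sqr_sqrtr (ltW eps0)) rmorphXn /=.
by rewrite ler_sqr ?nnegrE ?(ltW eps1)// ltW//; exact: F0u.
Qed.

Section Diagonal.
Variables (I : choiceType) (e : I -> H) (P : H -> H) (c : I -> R).
Hypothesis e_basis : orthonormal_basis ip e.
Hypothesis Pb : bounded_operator P.
Hypothesis Pe : forall i, P (e i) = (c i)%:C *: e i.
Hypothesis c0 : forall i, 0 <= c i.

Lemma diagonal_quadratic_approx u (eps : K) : 0 < eps ->
  exists F : {fset I},
    `|ip (P u) u - (\sum_(i <- F) c i * sqmod (ip u (e i)))%:C| <= eps.
Proof.
have [e_orth e_total] := e_basis.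
have [M M0 PM] := bounded_operator_bound Pb => eps0.
have /complex_realP[r rE] : eps / M \is Num.real.
  by rewrite gtr0_real// divr_gt0.
have r0 : 0 < r by rewrite -ltcR -rE divr_gt0.
have r1 : 0 < (Num.sqrt r)%:C :> K by rewrite ltcR sqrtr_gt0.
have [F /(_ _ (fsubset_refl _)) Fu] := orth_proj_approx Hip e_orth e_total u r1.
exists F; rewrite (diagonal_quadratic Hip e_orth e_total Pb Pe F).
rewrite addrAC subrr add0r.
set w := u - _; rewrite (le_trans (cauchy_schwarz Hip _ _))//.
rewrite (le_trans (ler_wpM2r _ (PM _)))// -mulrA -expr2.
rewrite mulrC -ler_pdivlMr// rE -(sqr_sqrtr (ltW r0)) rmorphXn /=.
by rewrite lerXn2r ?nnegrE// ltW.
Qed.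

Lemma diagonal_positive u : 0 <= ip (P u) u.
Proof.
apply: ge0_approx => eps eps0; have [F Fe] := diagonal_quadratic_approx u eps0.
exists (\sum_(i <- F) c i * sqmod (ip u (e i)))%:C => //.
by rewrite ler0c sumr_ge0// => i _; rewrite mulr_ge0// sqmod_ge0.
Qed.

Lemma diagonal_quadratic_esum u :
  (\esum_(i in [set: I]) (c i * sqmod (ip u (e i)))%:E =
    (complex.Re (ip (P u) u))%:E)%E.
Proof.
have [e_orth e_total] := e_basis.
have qE : (complex.Re (ip (P u) u))%:C = ip (P u) u.
  by rewrite RRe_real// ger0_real// diagonal_positive.
apply/esum_eqP.
split=> [F|eps eps0].
  rewrite -lecR qE (diagonal_quadratic Hip e_orth e_total Pb Pe F).
  by rewrite lerDl diagonal_positive.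
have eps1 : 0 < eps%:C :> K by rewrite ltcR.
have [F b] := diagonal_quadratic_approx u eps1; exists F.
rewrite lerBlDl -lerBlDr -lecR (le_trans _ b)// rmorphB /= qE.
by apply: real_ler_norm; rewrite -qE -rmorphB complex_real.
Qed.

(** <P f_j, f_j> is the sum over i of c_i |<f_j, e_i>|^2; summing over j first
    gives c_i by Parseval's identity for e_i in the basis f. *)
Lemma diagonal_diagonal_sum (t : R) :
  (\esum_(i in [set: I]) (c i)%:E = t%:E)%E -> diagonal_sum ip P t%:C.
Proof.
move=> ct J f f_basis.
have -> : (fun j => ip (P (f j)) (f j)) =
    (fun j => (complex.Re (ip (P (f j)) (f j)))%:C).
  by apply/funext => j; rewrite RRe_real// ger0_real// diagonal_positive.
apply: esum_partial_sum.
  by move=> j; rewrite -lecR RRe_real ?ger0_real// diagonal_positive.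
have [e_orth e_total] := e_basis.
under eq_esum do rewrite -diagonal_quadratic_esum.
rewrite -ct.
have a0 i j : (0 <= (c i * sqmod (ip (f j) (e i)))%:E)%E.
  by rewrite lee_fin mulr_ge0// sqmod_ge0.
rewrite exchange_esum//; apply: eq_esum => i _.
rewrite -[in RHS](mulr1 (c i)); apply: esumZl_real => //.
  by move=> j; exact: sqmod_ge0.
under eq_esum do rewrite (ipC ip) /sqmod norm_conjC -/(sqmod _).
rewrite (parseval _ f_basis); congr (_%:E); apply: (@complexI R).
by rewrite sqmodE normr_id -Hip e_orth eqxx.
Qed.
End Diagonal.
End Trace.

(** * Spherical joint weighted shifts *)

Section Shift.
Variables (R : realType) (H : completeNormedModType R[i]).
Variables (ip : inner_product H) (Hip : induces_norm ip).
Variables (m : nat) (x : multi_index m.+1 -> H).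
Variables (delta : nat -> R) (T : 'I_m.+1 -> H -> H).
Hypothesis x_basis : orthonormal_basis ip x.
Hypothesis T_shift : spherical_shift x delta T.
Local Notation K := R[i].
Local Notation d := m.+1.

Let f n : R := delta n / Num.sqrt (n + d)%:R.

Let f_sqr n : f n ^+ 2 = delta n ^+ 2 / (n + d)%:R.
Proof. by rewrite /f expr_div_n sqr_sqrtr. Qed.

Let T_bounded i : bounded_operator (T i).
Proof. by case: T_shift. Qed.

(** The vector z^a of norm sqrt (a!).  It is locked so that rewriting with the
    scaling rules does not see the scalar inside. *)
Definition monomial (a : multi_index d) : H :=
  locked ((Num.sqrt (mi_fact a)%:R)%:C *: x a).
Local Notation y := monomial.

Let monomialE a : y a = (Num.sqrt (mi_fact a)%:R)%:C *: x a.
Proof. by rewrite /monomial -lock. Qed.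

Let sqrt_fact_neq0 (a : multi_index d) : (Num.sqrt (mi_fact a)%:R)%:C != 0 :> K.
Proof. by rewrite gt_eqF// ltcR sqrtr_gt0 ltr0n mi_fact_gt0. Qed.

Lemma basis_monomial a : x a = (Num.sqrt (mi_fact a)%:R)%:C^-1 *: y a.
Proof. by rewrite monomialE scalerA mulVf ?sqrt_fact_neq0// scale1r. Qed.

Lemma ip_monomial a b : ip (y a) (y b) = ((a == b) * mi_fact a)%:R%:C.
Proof.
have [x_orth _] := x_basis.
rewrite !monomialE ipZl ipZr conj_real x_orth.
have [->|_] := eqVneq a b; last by rewrite mul0n !mulr0.
by rewrite mulr1 mul1n -rmorphM /= -expr2 sqr_sqrtr.
Qed.

Lemma shift_monomial i a : T i (y a) = (f (mi_abs a))%:C *: y (mi_incr a i).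
Proof.
have [_ _ _ Tx] := T_shift.
rewrite !monomialE (bounded_operatorZ _ _ (T_bounded i)) Tx !scalerA.
rewrite -!rmorphM /=.
congr (_%:C *: _).
rewrite mi_fact_incr natrM !sqrtrM// sqrtrV// addn1 /f; ring.
Qed.

(** In terms of monomials the adjoint of multiplication by z_j is d/dz_j; the
    factor b_j is the ratio of the squared norms b! and (b - e_j)!. *)
Let adjoint_formula j a b :
  ip (T j (x a)) (y b) =
  ip (x a) ((f (mi_abs b).-1 * (b j)%:R)%:C *: y (mi_decr b j)).
Proof.
rewrite basis_monomial (bounded_operatorZ _ _ (T_bounded j)) shift_monomial.
rewrite [LHS]ipZl [X in _ * X = _]ipZl [RHS]ipZl [X in _ = _ * X]ipZr conj_real.
rewrite !ip_monomial -!rmorphM /=; congr (_ * _%:C).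
have [bj|bj] := posnP (b j).
  by rewrite mi_incr_eq bj /= !mulr0 mul0r.
rewrite -(mi_abs_decr bj) /= mi_incr_eq bj /=.
have [->|_] := eqVneq a (mi_decr b j); last by rewrite !mul0n !mulr0.
rewrite /= !mul1n -[RHS]mulrA -natrM; congr (_ * _%:R).
by rewrite mi_fact_incr ffunE eqxx subn1 prednK.
Qed.

Lemma adjointP j u v : ip (T j u) v = ip u (adjoint ip (T j) v).
Proof.
have [x_orth x_total] := x_basis.
apply: (adjointE Hip x_total (T_bounded j)) => b.
exists ((Num.sqrt (mi_fact b)%:R)%:C^-1 *:
  ((f (mi_abs b).-1 * (b j)%:R)%:C *: y (mi_decr b j))) => w.
rewrite basis_monomial [LHS]ipZr [RHS]ipZr; congr (_ * _).
by apply: (ip_eq_on_basis Hip x_total) => // a; exact: adjoint_formula.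
Qed.

Lemma adjoint_monomial j b : adjoint ip (T j) (y b) =
  (f (mi_abs b).-1 * (b j)%:R)%:C *: y (mi_decr b j).
Proof.
have [x_orth x_total] := x_basis.
apply: (eq_of_ip_eq Hip) => u; rewrite -adjointP.
by apply: (ip_eq_on_basis Hip x_total) => // a; exact: adjoint_formula.
Qed.

Lemma comm_block_bounded i j : bounded_operator (comm_block ip T i j).
Proof.
have adjb := adjoint_bounded Hip (T_bounded j) (adjointP j).
by apply: bounded_sub; apply: bounded_comp.
Qed.

Lemma comm_block_monomial i j a :
  comm_block ip T i j (y a) =
  (up_weight m delta (mi_abs a) * (i == j)%:R)%:C *: y a +
  ((up_weight m delta (mi_abs a) - down_weight m delta (mi_abs a)) *
     (a j)%:R)%:C *: y (mi_incr (mi_decr a j) i).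
Proof.
have hE : up_weight m delta (mi_abs a) = f (mi_abs a) ^+ 2 by rewrite f_sqr.
have pE : down_weight m delta (mi_abs a) = f (mi_abs a).-1 ^+ 2.
  by rewrite f_sqr.
set h := up_weight _ _ _ in hE *; set p := down_weight _ _ _ in pE *.
have adjb := adjoint_bounded Hip (T_bounded j) (adjointP j).
rewrite /comm_block /Defs.commutator adjoint_monomial shift_monomial.
rewrite (bounded_operatorZ _ (y _) adjb).
rewrite (bounded_operatorZ _ (y _) (T_bounded i)).
rewrite adjoint_monomial shift_monomial mi_abs_incr /= !scalerA -!rmorphM /=.
have -> : f (mi_abs a) * (f (mi_abs a) * (mi_incr a i j)%:R) =
    h * ((a j)%:R + (i == j)%:R).
  by rewrite hE ffunE natrD [j == i]eq_sym; ring.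
have -> : f (mi_abs a).-1 * (a j)%:R * f (mi_abs (mi_decr a j)) = p * (a j)%:R.
  rewrite pE; have [->|aj] := posnP (a j); first by rewrite !(mulr0, mul0r).
  rewrite -(mi_abs_decr aj) /=; ring.
have [<-|ij] := eqVneq i j; last first.
  rewrite mi_decr_incr// mulr0 rmorph0 scale0r add0r addr0 -scalerBl -rmorphB.
  by rewrite mulrBl.
(* On the diagonal a + e_i - e_i = a, and a - e_i + e_i = a unless a_i = 0, when
   the coefficient vanishes. *)
have raise_lower c : (c * (a i)%:R)%:C *: y (mi_incr (mi_decr a i) i) =
    (c * (a i)%:R)%:C *: y a.
  have [->|ai] := posnP (a i); first by rewrite mulr0 rmorph0 !scale0r.
  by rewrite mi_decrK.
rewrite mi_incrK !raise_lower -scalerBl -scalerDl; congr (_ *: _).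
by rewrite -rmorphB -[RHS]rmorphD /=; congr (_%:C); ring.
Qed.

Lemma dEt_basis a :
  dEt (comm_block ip T) (x a) = (dEt_eigenvalue m delta (mi_abs a))%:C *: x a.
Proof.
set n := mi_abs a; set h := up_weight m delta n; set p := down_weight m delta n.
pose B i j : {linear H -> H} := HB.pack (comm_block ip T i j)
  (GRing.isLinear.Build _ _ _ _ (comm_block ip T i j)
    (proj1 (comm_block_bounded i j))).
pose G i j : {linear H -> H} := (B i j \- ((h%:C * (i == j)%:R) \*: idfun))%FUN.
have BE i j u : B i j u = G i j u + (h%:C * (i == j)%:R) *: u.
  by rewrite /G /= subrK.
have Gy i j b : mi_abs b = n ->
    G i j (y b) = ((h - p)%:C * (b j)%:R) *: y (mi_incr (mi_decr b j) i).
  move=> bn; rewrite /G /= comm_block_monomial bn -/h -/p addrAC rmorphM /=.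
  by rewrite !rmorph_nat subrr add0r rmorphM rmorph_nat.
have Gyy i : G i i (y a) = ((h - p)%:C * (a i)%:R) *: y a.
  rewrite Gy//; have [->|ai] := posnP (a i); first by rewrite mulr0 !scale0r.
  by rewrite mi_decrK.
have := dEt_eigenvector (ltn0Sn m) BE
  (fun i j k l => quadratic_relation Gy i j k l (erefl : mi_abs a = n)) Gyy.
rewrite -[dEt _]/(dEt (comm_block ip T)) => E.
rewrite basis_monomial.
rewrite (bounded_operatorZ _ _ (bounded_dEt comm_block_bounded)) E.
rewrite !scalerA mulrC; congr (_ * _ *: _).
rewrite /dEt_eigenvalue -/h -/p -natr_sum -/(mi_abs a) -/n.
rewrite -rmorphB /= opprB addrCA subrr addr0.
move: (h) (p) => h' p'.
by rewrite rmorphM rmorphD !rmorphM rmorphB !rmorphXn !rmorph_nat.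
Qed.
End Shift.

Unset Implicit Arguments.

Theorem corollary5p3 (R : realType) (H : completeNormedModType R[i])
    (ip : inner_product H) (d : nat) (x : multi_index d -> H)
    (delta : nat -> R) (T : 'I_d -> H -> H)
    (Hip : induces_norm ip)
    (Hd : (0 < d)%N)
    (Hx : orthonormal_basis ip x)
    (HT : spherical_shift x delta T)
    (Hincr : nondecreasing_seq delta)
    (Hlim : delta n @[n --> \oo] --> (1 : R)) :
  has_trace ip (dEt (comm_block ip T)) 1.
Proof.
case: d Hd x T Hx HT => // m _ x T Hx HT.
have [delta_gt0 _ _ _] := HT.
have Db := bounded_dEt (comm_block_bounded Hip Hx HT).
have Dx := dEt_basis Hip Hx HT.
have eigen0 (a : multi_index m.+1) :=
  dEt_eigenvalue_ge0 m delta_gt0 Hincr (mi_abs a).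
have sum1 : diagonal_sum ip (dEt (comm_block ip T)) 1.
  apply: (diagonal_diagonal_sum Hip Hx Db Dx eigen0).
  exact: (esum_dEt_eigenvalue m delta_gt0 Hincr Hlim).
have [x_orth x_total] := Hx.
split=> //; split=> //; exists (dEt (comm_block ip T)); split; last by exists 1.
split; first by split=> // u; exact: (diagonal_positive Hip Hx Db Dx eigen0).
(* dEt is selfadjoint, so its square is dEt^* dEt. *)
rewrite (adjoint_unique Hip (A := dEt _) (B := dEt (comm_block ip T)))//.
exact: (diagonal_selfadjoint Hip x_orth x_total Db Dx).
Qed.
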